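(* Let $\psi:M^m\to(0,\infty)\times_{\sinh t}\mathbb S^n=\mathbb H^{n+1}\setminus\{o\}$ be a stochastically complete mean curvature flow soliton with respect to $X=\sinh t\,\partial_t$ and constant $c<0$. Let $t^*=\sup_M(\pi\circ\psi)$. Then $$t^*\ge\operatorname{arccosh}\left(-\frac{m+\sqrt{m^2+4c^2}}{2c}\right).$$
   Context: $(0,\infty)\times_{\sinh t}\mathbb S^n$ is $(0,\infty)\times\mathbb S^n$ with metric $dt^2+\sinh^2t\,g_{\mathbb S^n}$, which is hyperbolic space of curvature $-1$ minus a point $o$; $\pi(t,p)=t$. An isometric immersion $\psi:M^m\to\bar M^{n+1}$ is a mean curvature flow soliton with respect to a vector field $X$ on $\bar M$ if $c\,X^\perp=\mathbf H$ along $\psi$ for some constant $c\in\mathbb R$, where $\perp$ is projection on the normal bundle and $\mathbf H$ is the non-normalized mean curvature vector (the trace of the second fundamental form). $M$ (with the induced metric) is stochastically complete if Brownian motion on $M$ has infinite lifetime almost surely; equivalently, the weak maximum principle holds for the Laplacian: for every $u\in C^2(M)$ with $u^*=\sup_Mu<\infty$ and every $\gamma<u^*$, $\inf_{\{u>\gamma\}}\Delta u\le0$. The value $t^*=+\infty$ is allowed. *)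

(* Defs.v *)
From HB Require Import structures.
From mathcomp Require Import all_boot all_order all_algebra.
From mathcomp Require Import all_classical all_reals all_analysis.
Set Implicit Arguments.
Unset Strict Implicit.
Unset Printing Implicit Defensive.
Import Order.TTheory GRing.Theory Num.Theory.
Import numFieldNormedType.Exports.
Local Open Scope classical_set_scope.
Local Open Scope ring_scope.

Definition sinh (R : realType) (t : R) : R := (expR t - expR (- t)) / 2.

Definition cosh (R : realType) (t : R) : R := (expR t + expR (- t)) / 2.

Definition arccosh (R : realType) (y : R) : R := ln (y + Num.sqrt (y ^+ 2 - 1)).

Lemma arccoshK (R : realType) (y : R) : 1 <= y -> cosh (arccosh y) = y.
Proof.
move=> y1; rewrite /cosh /arccosh expRN.
have d0 : 0 <= y ^+ 2 - 1 by rewrite subr_ge0 expr_ge1 // (le_trans ler01 y1).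
set s := Num.sqrt _.
have z0 : 0 < y + s by rewrite ltr_pwDl ?sqrtr_ge0 // (lt_le_trans ltr01 y1).
have zs : (y + s) * (y - s) = 1.
  by rewrite mulrC -subr_sqr sqr_sqrtr // opprB addrC subrK.
rewrite lnK ?posrE //.
have -> : (y + s)^-1 = y - s.
  by apply: (mulfI (lt0r_neq0 z0)); rewrite zs mulfV ?lt0r_neq0.
by rewrite addrACA subrr addr0 -mulr2n -[y *+ 2]mulr_natr mulfK ?pnatr_eq0.
Qed.

Lemma arccosh_ge0 (R : realType) (y : R) : 1 <= y -> 0 <= arccosh y.
Proof. by move=> y1; rewrite ln_ge0 // ler_wpDr ?sqrtr_ge0. Qed.

Definition pderiv (R : realType) (N : nat) (k : 'I_N) (f : 'rV[R]_N -> R) :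
    'rV[R]_N -> R :=
  'D_(delta_mx 0 k : 'rV[R]_N) f.

(* Intended for open [U]. *)
Fixpoint Ck (R : realType) (N : nat) (r : nat) (U : set 'rV[R]_N)
    (f : 'rV[R]_N -> R) : Prop :=
  (forall x, U x -> {for x, continuous f}) /\
  (if r is r'.+1 then
     forall k : 'I_N,
       (forall x, U x -> derivable f x (delta_mx 0 k : 'rV[R]_N)) /\
       Ck r' U (pderiv k f)
   else True).

Definition smooth_map (R : realType) (N P : nat) (U : set 'rV[R]_N)
    (f : 'rV[R]_N -> 'rV[R]_P) : Prop :=
  forall (j : 'I_P) (r : nat), Ck r U (fun x => f x 0 j).

Definition inner (R : realType) (N : nat) (g : 'M[R]_N) (v w : 'rV[R]_N) : R :=
  (v *m g *m w^T) 0 0.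

(* The symbol Gamma^k_(ij) of the Levi-Civita connection of [g]. *)
Definition christoffel (R : realType) (N : nat) (g : 'rV[R]_N -> 'M[R]_N)
    (k i j : 'I_N) (x : 'rV[R]_N) : R :=
  2^-1 * \sum_(l < N) invmx (g x) k l *
    (pderiv i (fun y => g y j l) x + pderiv j (fun y => g y i l) x
     - pderiv l (fun y => g y i j) x).

(* The [g]-trace of the Hessian of [f]. *)
Definition local_laplacian (R : realType) (N : nat) (g : 'rV[R]_N -> 'M[R]_N)
    (f : 'rV[R]_N -> R) (x : 'rV[R]_N) : R :=
  \sum_(a < N) \sum_(b < N) invmx (g x) a b *
    (pderiv a (pderiv b f) x - \sum_(k < N) christoffel g k a b x * pderiv k f x).

Definition jac (R : realType) (m N : nat) (F : 'rV[R]_m -> 'rV[R]_N)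
    (x : 'rV[R]_m) : 'M[R]_(m, N) :=
  \matrix_(a, k) pderiv a (fun y => F y 0 k) x.

Definition pullback_metric (R : realType) (m N : nat) (h : 'rV[R]_N -> 'M[R]_N)
    (F : 'rV[R]_m -> 'rV[R]_N) (x : 'rV[R]_m) : 'M[R]_m :=
  \matrix_(a, b) inner (h (F x)) (row a (jac F x)) (row b (jac F x)).

(* [v] minus its [h]-orthogonal projection on the span of the d_a F. *)
Definition normal_part (R : realType) (m N : nat) (h : 'rV[R]_N -> 'M[R]_N)
    (F : 'rV[R]_m -> 'rV[R]_N) (x : 'rV[R]_m) (v : 'rV[R]_N) : 'rV[R]_N :=
  v - \sum_(a < m) \sum_(b < m)
        (invmx (pullback_metric h F x) a b * inner (h (F x)) v (row b (jac F x)))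
          *: row a (jac F x).

(* The ambient covariant derivative along [F] of the field d_b F in the
   direction d_a. *)
Definition cov_deriv (R : realType) (m N : nat) (h : 'rV[R]_N -> 'M[R]_N)
    (F : 'rV[R]_m -> 'rV[R]_N) (a b : 'I_m) (x : 'rV[R]_m) : 'rV[R]_N :=
  \row_k (pderiv a (pderiv b (fun y => F y 0 k)) x
          + \sum_(i < N) \sum_(j < N)
              christoffel h k i j (F x) * jac F x a i * jac F x b j).

Definition second_form (R : realType) (m N : nat) (h : 'rV[R]_N -> 'M[R]_N)
    (F : 'rV[R]_m -> 'rV[R]_N) (a b : 'I_m) (x : 'rV[R]_m) : 'rV[R]_N :=
  normal_part h F x (cov_deriv h F a b x).

Definition mean_curvature (R : realType) (m N : nat) (h : 'rV[R]_N -> 'M[R]_N)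
    (F : 'rV[R]_m -> 'rV[R]_N) (x : 'rV[R]_m) : 'rV[R]_N :=
  \sum_(a < m) \sum_(b < m)
    invmx (pullback_metric h F x) a b *: second_form h F a b x.

(* A nonempty Hausdorff second countable manifold with a smooth atlas.
   [param i] is the inverse of the chart [chart i], with arbitrary values outside
   [chart i @` dom i].  [chart_at p] selects a chart around [p]; tensorial
   quantities at [p] are computed in that chart, the choice being immaterial. *)
Record manifold (R : realType) (m : nat) := Manifold {
  carrier :> topologicalType;
  index : Type;
  dom : index -> set carrier;
  chart : index -> carrier -> 'rV[R]_m;
  param : index -> 'rV[R]_m -> carrier;
  chart_at : carrier -> index;
  manifold_nonempty : [set: carrier] !=set0;
  manifold_hausdorff : hausdorff_space carrier;
  manifold_second_countable : @second_countable carrier;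
  dom_open : forall i, open (dom i);
  img_open : forall i, open (chart i @` dom i);
  chartK : forall i p, dom i p -> param i (chart i p) = p;
  chart_continuous : forall i, {within dom i, continuous (chart i)};
  param_continuous : forall i, {within chart i @` dom i, continuous (param i)};
  dom_chart_at : forall p, dom (chart_at p) p;
  transition_smooth : forall i j,
    smooth_map (chart i @` (dom i `&` dom j)) (chart j \o param i)
}.

Definition img (R : realType) (m : nat) (M : manifold R m) (i : index M) :
    set 'rV[R]_m :=
  chart i @` dom i.

Definition C2_fun (R : realType) (m : nat) (M : manifold R m) (u : M -> R) : Prop :=
  forall i : index M, Ck 2 (img i) (u \o param i).

(* A metric on [M] is given by its matrices in all charts. *)
Definition laplacian (R : realType) (m : nat) (M : manifold R m)
    (g : index M -> 'rV[R]_m -> 'M[R]_m) (u : M -> R) (p : M) : R :=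
  let i := chart_at p in local_laplacian (g i) (u \o param i) (chart i p).

(* Stochastic completeness, expressed by the weak maximum principle for the
   Laplacian. *)
Definition stochastically_complete (R : realType) (m : nat) (M : manifold R m)
    (g : index M -> 'rV[R]_m -> 'M[R]_m) : Prop :=
  forall u : M -> R, C2_fun u ->
    (ereal_sup [set (u p)%:E | p in [set: M]] < +oo)%E ->
    forall gamma : R,
      (gamma%:E < ereal_sup [set (u p)%:E | p in [set: M]])%E ->
      (ereal_inf [set (laplacian g u p)%:E | p in [set p | (gamma < u p)%R]] <= 0)%E.

(* The ambient manifold is identified with an open subset of R^N by a global
   chart; [h] is its metric, [X] a vector field on it and [Psi] the immersion,
   all read in that chart. *)

Definition local_expr (R : realType) (m N : nat) (M : manifold R m)
    (Psi : M -> 'rV[R]_N) (i : index M) : 'rV[R]_m -> 'rV[R]_N :=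
  Psi \o param i.

Definition immersion (R : realType) (m N : nat) (M : manifold R m)
    (Psi : M -> 'rV[R]_N) : Prop :=
  (forall i : index M, smooth_map (img i) (local_expr Psi i)) /\
  (forall p : M,
     row_free (jac (local_expr Psi (chart_at p)) (chart (chart_at p) p))).

Definition induced_metric (R : realType) (m N : nat) (M : manifold R m)
    (h : 'rV[R]_N -> 'M[R]_N) (Psi : M -> 'rV[R]_N) (i : index M) :
    'rV[R]_m -> 'M[R]_m :=
  pullback_metric h (local_expr Psi i).

Definition mcf_soliton (R : realType) (m N : nat) (M : manifold R m)
    (h : 'rV[R]_N -> 'M[R]_N) (X : 'rV[R]_N -> 'rV[R]_N) (c : R)
    (Psi : M -> 'rV[R]_N) : Prop :=
  immersion Psi /\
  forall p : M,
    let F := local_expr Psi (chart_at p) in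
    let x := chart (chart_at p) p in
    c *: normal_part h F x (X (Psi p)) = mean_curvature h F x.

Definition enorm (R : realType) (N : nat) (x : 'rV[R]_N) : R :=
  Num.sqrt (\sum_(k < N) x 0 k ^+ 2).

(* The underlying set (0, oo) x S^n, with S^n the unit sphere of R^(n+1). *)
Definition warped_product (R : realType) (n : nat) : set (R * 'rV[R]_n.+1) :=
  [set q | 0 < q.1 /\ enorm q.2 = 1].

(* The global chart (t, p) |-> t p, a diffeomorphism onto R^(n+1) minus the
   origin with inverse x |-> (enorm x, direction x). *)
Definition polar (R : realType) (n : nat) (q : R * 'rV[R]_n.+1) : 'rV[R]_n.+1 :=
  q.1 *: q.2.

Definition direction (R : realType) (N : nat) (x : 'rV[R]_N) : 'rV[R]_N :=
  (enorm x)^-1 *: x.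

(* dt^2 + rho(t)^2 g_(S^n) in the chart [polar], where t = enorm x and
   g_(S^n) is the restriction of the Euclidean metric of R^(n+1). *)
Definition warped_metric (R : realType) (n : nat) (rho : R -> R)
    (x : 'rV[R]_n.+1) : 'M[R]_n.+1 :=
  \matrix_(i, j)
    (pderiv i (@enorm R n.+1) x * pderiv j (@enorm R n.+1) x
     + rho (enorm x) ^+ 2 *
       inner 1%:M (row i (jac (@direction R n.+1) x))
                  (row j (jac (@direction R n.+1) x))).

(* rho(t) d/dt in the chart [polar]: the t-derivative of t p is p. *)
Definition warped_field (R : realType) (n : nat) (rho : R -> R)
    (x : 'rV[R]_n.+1) : 'rV[R]_n.+1 :=
  rho (enorm x) *: direction x.

(* Main.v *)
(* On hyperbolic space Hess(cosh t) = cosh t <,>, so on the soliton the function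
   u = cosh t satisfies
     Delta u = m u + <sinh t d_t, H> = m u + c |(sinh t d_t)^perp|^2
             >= m u + c (u^2 - 1),
   as c < 0 and |sinh t d_t|^2 = sinh^2 t = u^2 - 1. The right-hand side is
   c (u - y0) (u + 1/y0), where y0 is the bound on cosh t to be proved. If
   sup u < y0, it is bounded below by a positive constant, against the weak
   maximum principle applied to u.
   The identity for Delta u is checked in coordinates: the metric is
   A(|x|) <v,w> + B(|x|) <x,v> <x,w>, so all tensors below are expressed
   through Euclidean products, and the Gauss formula and the Hessian identity
   become rational identities between them. *)

Require Import Defs.
From HB Require Import structures.
From mathcomp Require Import all_boot all_order all_algebra.
From mathcomp Require Import all_classical all_reals all_analysis.
From mathcomp Require Import ring lra.
Import Order.TTheory GRing.Theory Num.Theory.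
Import numFieldNormedType.Exports.
Local Open Scope classical_set_scope.
Local Open Scope ring_scope.
Set Implicit Arguments.
Unset Strict Implicit.
Unset Printing Implicit Defensive.

(** * Directional derivatives and the Euclidean product *)

Section DirectionalDerivatives.
Variables (R : realType) (V : normedModType R).
Implicit Types (x v : V) (f g : V -> R).

(** Restriction to the line through [x] brings a directional derivative down to one real variable,
    where the chain rule and the mean value theorem apply. *)
Lemma is_derive_lineP f x v (d : R) :
  is_derive x v f d <-> is_derive (0 : R) (1 : R) (fun h : R => f (h *: v + x)) d.
Proof.
have E : 'D_v f x = 'D_(1 : R) (fun h : R => f (h *: v + x)) (0 : R).
  rewrite /derive; apply: (congr1 (fun g : R -> R => lim (g @ 0^'))); apply/funext => h /=.
  by rewrite addr0 scale0r add0r [_%:A]mulr1.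
have P := derivable1P f x v.
by split=> -[/P fd <-]; [rewrite E; split|split].
Qed.

Lemma is_derive_comp1 (phi : R -> R) f x v (a b : R) :
  is_derive (f x : R) (1 : R) phi a -> is_derive x v f b ->
  is_derive x v (phi \o f) (a * b).
Proof.
move=> dphi /is_derive_lineP df; apply/is_derive_lineP.
by apply: (@is_derive1_comp _ phi (fun h : R => f (h *: v + x)) 0);
  rewrite ?scale0r ?add0r.
Qed.

Lemma is_derive_mul f g x v (a b : R) :
  is_derive x v f a -> is_derive x v g b ->
  is_derive x v (fun y => f y * g y) (a * g x + f x * b).
Proof.
move=> df dg; apply: is_derive_eq (is_deriveM df dg) _.
by rewrite addrC mulrC.
Qed.

Lemma is_derive_add f g x v (a b : R) :
  is_derive x v f a -> is_derive x v g b ->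
  is_derive x v (fun y => f y + g y) (a + b).
Proof. exact: is_deriveD. Qed.

Lemma is_derive_bigsum n (f : 'I_n -> V -> R) x v (a : 'I_n -> R) :
  (forall i, is_derive x v (f i) (a i)) ->
  is_derive x v (fun y => \sum_(i < n) f i y) (\sum_(i < n) a i).
Proof.
move=> /is_derive_sum; congr (is_derive _ _ _ _).
by apply/funext => y; rewrite fct_sumE.
Qed.

End DirectionalDerivatives.

(** * The Euclidean product and norm of row vectors *)

Section Dot.
Variables (R : realType) (N : nat).
Implicit Types u v w : 'rV[R]_N.

Definition dot v w : R := \sum_(k < N) v 0 k * w 0 k.

Lemma dotC v w : dot v w = dot w v.
Proof. by apply: eq_bigr => k _; rewrite mulrC. Qed.

Lemma dotDl u v w : dot (u + v) w = dot u w + dot v w.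
Proof. by rewrite -big_split; apply: eq_bigr => k _; rewrite mxE mulrDl. Qed.

Lemma dotZl (a : R) v w : dot (a *: v) w = a * dot v w.
Proof. by rewrite /dot mulr_sumr; apply: eq_bigr => k _; rewrite mxE mulrA. Qed.

Lemma dotDr u v w : dot u (v + w) = dot u v + dot u w.
Proof. by rewrite dotC dotDl !(dotC u). Qed.

Lemma dotZr (a : R) v w : dot v (a *: w) = a * dot v w.
Proof. by rewrite dotC dotZl dotC. Qed.

Lemma dot_delta v k : dot v (delta_mx 0 k) = v 0 k.
Proof.
rewrite /dot (bigD1 k) //= mxE !eqxx mulr1 big1 ?addr0 // => i ik.
by rewrite mxE (negbTE ik) andbF mulr0.
Qed.

Lemma dot_ge0 v : 0 <= dot v v.
Proof. by apply: sumr_ge0 => k _; rewrite -expr2 sqr_ge0. Qed.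

Lemma dot_eq0 v : dot v v = 0 -> v = 0.
Proof.
move=> v0; apply/rowP => k; rewrite mxE.
have /psumr_eq0P/(_ v0 k isT)/eqP : forall i : 'I_N, true -> 0 <= v 0 i * v 0 i.
  by move=> i _; rewrite -expr2 sqr_ge0.
by rewrite mulf_eq0 orbb => /eqP.
Qed.

Lemma enormE v : enorm v = Num.sqrt (dot v v).
Proof. by congr Num.sqrt; apply: eq_bigr => k _; rewrite expr2. Qed.

Lemma enorm_sqr v : enorm v ^+ 2 = dot v v.
Proof. by rewrite enormE sqr_sqrtr ?dot_ge0. Qed.

Lemma enorm_gt0 v : v != 0 -> 0 < enorm v.
Proof.
move=> v0; rewrite enormE sqrtr_gt0 lt0r dot_ge0 andbT.
by apply: contra_neq v0; exact: dot_eq0.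
Qed.

Lemma enormZ (a : R) v : 0 <= a -> enorm (a *: v) = a * enorm v.
Proof.
move=> a0; rewrite !enormE dotZl dotZr mulrA -expr2 sqrtrM ?sqr_ge0 //.
by rewrite sqrtr_sqr ger0_norm.
Qed.

Lemma cauchy_schwarz v w : dot v w ^+ 2 <= dot v v * dot w w.
Proof.
have [->|w0] := eqVneq w 0.
  by rewrite -[X in dot v X](scale0r 0) dotZr mul0r expr0n /= mulr_ge0 ?dot_ge0.
have ww : 0 < dot w w by rewrite -enorm_sqr exprn_gt0 // enorm_gt0.
(* This vector is [dot w w] times the component of [v] orthogonal to [w]; its square is [dot w w]
   times the difference of the two sides. *)
have := dot_ge0 (dot w w *: v + (- dot v w) *: w).
rewrite !(dotDl, dotDr, dotZl, dotZr) (dotC w v) => H.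
rewrite -subr_ge0 -(pmulr_rge0 _ ww); apply: le_trans H _.
by rewrite le_eqVlt; apply/orP; left; apply/eqP; ring.
Qed.

End Dot.

(** * Symmetry of second derivatives *)

Section Schwarz.
Variables (R : realType) (V : normedModType R).
Implicit Types (x v w : V) (f g : V -> R) (U : set V).

Lemma is_derive_line f x v (t d : R) : is_derive (t *: v + x) v f d ->
  is_derive t (1 : R) (fun h : R => f (h *: v + x)) d.
Proof.
move=> /is_derive_lineP df; apply/is_derive_lineP.
congr (is_derive _ _ _ _): df.
by apply/funext => h; rewrite [_%:A]mulr1 scalerDl addrA.
Qed.

Lemma line_mean_value f x v (h : R) : 0 < h ->
  (forall s, 0 <= s <= h -> derivable f (s *: v + x) v) ->
  exists2 s, 0 <= s <= h & f (h *: v + x) - f x = 'D_v f (s *: v + x) * h.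
Proof.
move=> h0 df.
pose g t : R := f (t *: v + x); pose dg t : R := 'D_v f (t *: v + x).
have Dg t : 0 <= t <= h -> is_derive t (1 : R) g (dg t).
  by move=> /df ft; apply: is_derive_line; split.
have [s|t|s] := @MVT R g dg 0 h h0.
- by rewrite in_itv /= => /andP[/ltW s0 /ltW sh]; apply: Dg; rewrite s0.
- apply: derivable_within_continuous => {}t; rewrite in_itv /= => /Dg.
  by case.
rewrite in_itv /= => /andP[/ltW s0 /ltW sh].
by rewrite /g scale0r add0r subr0 => E; exists s; rewrite ?s0.
Qed.

(** Two mean value steps: along [v] for the increment [g] of [f] in the direction [w], then along
    [w] for ['D_v f]. *)
Lemma second_difference f U x v w (h : R) : 0 < h ->
  (forall y, U y -> derivable f y v) ->
  (forall y, U y -> derivable ('D_v f) y w) ->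
  (forall s t : R, 0 <= s <= h -> 0 <= t <= h -> U (s *: v + (t *: w + x))) ->
  exists s t : R, [/\ 0 <= s <= h, 0 <= t <= h &
    f (h *: v + (h *: w + x)) - f (h *: w + x) - (f (h *: v + x) - f x) =
    'D_w ('D_v f) (s *: v + (t *: w + x)) * h * h].
Proof.
move=> h0 fv fvw Uh.
have h00 : 0 <= (0 : R) <= h by rewrite lexx ltW.
have hh : 0 <= h <= h by rewrite lexx ltW.
pose g y := f (h *: w + y) - f y.
have Dg y : U (h *: w + y) -> U y ->
    is_derive y v g ('D_v f (h *: w + y) - 'D_v f y).
  move=> Uy1 Uy; apply: is_deriveB; last by split => //; exact: fv.
  apply/is_derive_lineP.
  have /is_derive_lineP : is_derive (h *: w + y) v f ('D_v f (h *: w + y)).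
    by split => //; exact: fv.
  congr (is_derive _ _ _ _).
  by apply/funext => t; rewrite addrCA.
have U1 s : 0 <= s <= h -> U (s *: v + x).
  by move=> sh; rewrite -[x]add0r -(scale0r w); exact: Uh.
have U2 s : 0 <= s <= h -> U (h *: w + (s *: v + x)).
  by move=> sh; rewrite addrCA; exact: Uh.
have [s sh] := @line_mean_value g x v h h0 (fun s sh =>
  @ex_derive _ _ _ _ _ _ _ (Dg _ (U2 s sh) (U1 s sh))).
rewrite (@derive_val _ _ _ _ _ _ _ (Dg _ (U2 s sh) (U1 s sh))) /g => Es.
have [t th Et] := @line_mean_value ('D_v f) (s *: v + x) w h h0 (fun t th =>
  fvw _ (eq_ind _ U (Uh s t sh th) _ (addrCA _ _ _))).
exists s, t; split => //.
rewrite [s *: v + _]addrCA -Et -Es [h *: v + (_ + _)]addrCA.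
by rewrite !opprB addrACA [RHS]addrACA [- _ + _ in RHS]addrC.
Qed.

Lemma common_radius f g U x (e : R) : open U -> U x ->
  {for x, continuous f} -> {for x, continuous g} -> 0 < e ->
  exists2 d : R, 0 < d & forall y, ball x d y ->
    [/\ U y, `|f x - f y| < e & `|g x - g y| < e].
Proof.
move=> Uo Ux fc gc e0.
have F1 : nbhs x U by exact: open_nbhs_nbhs.
have F2 : nbhs x [set y | `|f x - f y| < e].
  by move/cvgrPdist_lt : fc; apply.
have F3 : nbhs x [set y | `|g x - g y| < e].
  by move/cvgrPdist_lt : gc; apply.
have : nbhs x (U `&` ([set y | `|f x - f y| < e] `&` [set y | `|g x - g y| < e])).
  by apply: filterI => //; exact: filterI.
rewrite -nbhs_ballE => -[d /= d0 xd].
by exists d => // y /xd [? []].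
Qed.

(** The second difference over a small parallelogram is symmetric in [v] and [w], so it is [h * h]
    times either mixed derivative, each at some point near [x]. Continuity at [x] brings the two
    values together. *)
Lemma schwarz f U x v w : open U -> U x ->
  (forall y, U y -> derivable f y v) ->
  (forall y, U y -> derivable f y w) ->
  (forall y, U y -> derivable ('D_v f) y w) ->
  (forall y, U y -> derivable ('D_w f) y v) ->
  {for x, continuous ('D_w ('D_v f))} -> {for x, continuous ('D_v ('D_w f))} ->
  'D_w ('D_v f) x = 'D_v ('D_w f) x.
Proof.
move=> Uo Ux fv fw fvw fwv cvw cwv.
apply/eqP; rewrite -subr_eq0 -normr_le0; apply/ler_addgt0Pr => e e0.
rewrite add0r.
have close (a b z : R) : `|a - z| < e / 2 -> `|b - z| < e / 2 -> `|a - b| <= e.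
  rewrite (distrC b) => az zb; apply: le_trans (ler_distD z _ _) _.
  by rewrite [e in _ <= e]splitr; apply: lerD; exact: ltW.
have e20 : 0 < e / 2 by rewrite divr_gt0.
have [d d0 xd] := common_radius Uo Ux cvw cwv e20.
(* The parallelogram at [x] with sides [h *: v] and [h *: w] stays in the ball of radius [d]; the
   summand [1] keeps the denominator positive when [v] and [w] vanish. *)
pose h := d / 2 / (`|v| + `|w| + 1).
have vw0 : 0 < `|v| + `|w| + 1 by rewrite ltr_pwDr // addr_ge0.
have h0 : 0 < h by rewrite !divr_gt0.
have small s t : 0 <= s <= h -> 0 <= t <= h -> ball x d (s *: v + (t *: w + x)).
  move=> /andP[s0 sh] /andP[t0 th]; rewrite -ball_normE /=.
  rewrite addrA [X in _ - X]addrC opprD addrA subrr sub0r normrN.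
  apply: le_lt_trans (ler_normD _ _) _.
  rewrite !normrZ !ger0_norm //.
  apply: (@le_lt_trans _ _ (h * (`|v| + `|w| + 1))).
    rewrite !mulrDr mulr1 ler_wpDr ?(ltW h0) // lerD // ler_wpM2r //.
  by rewrite /h divfK ?gt_eqF // ltr_pdivrMr // ltr_pMr // ltr1n.
have [s [t [sh th E1]]] := @second_difference f U x v w h h0 fv fvw
  (fun s t sh th => let: And3 u _ _ := xd _ (small s t sh th) in u).
have small' s' t' : 0 <= s' <= h -> 0 <= t' <= h ->
    ball x d (s' *: w + (t' *: v + x)).
  by move=> sh' th'; rewrite addrCA; exact: small.
have [s' [t' [sh' th' E2]]] := @second_difference f U x w v h h0 fw fwv
  (fun s t sh th => let: And3 u _ _ := xd _ (small' s t sh th) in u).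
have [_ H1 _] := xd _ (small s t sh th).
have [_ _ H2] := xd _ (small' s' t' sh' th').
have E : 'D_w ('D_v f) (s *: v + (t *: w + x)) =
         'D_v ('D_w f) (s' *: w + (t' *: v + x)).
  apply: (mulIf (lt0r_neq0 h0)); apply: (mulIf (lt0r_neq0 h0)).
  apply: (etrans (esym E1)); apply: etrans E2.
  rewrite [h *: w + (h *: v + x)]addrCA.
  by ring.
rewrite E in H1.
exact: close H1 H2.
Qed.

End Schwarz.

(** * Calculus of C^k functions *)

Section CkCalculus.
Variables (R : realType) (N : nat).
Implicit Types (U : set 'rV[R]_N) (f g : 'rV[R]_N -> R) (r : nat).

Lemma continuous_at_near f g x : (\forall y \near x, f y = g y) ->
  {for x, continuous f} -> {for x, continuous g}.
Proof.
move=> fg fc; have E : f x = g x := nbhs_singleton fg.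
apply: (cvg_trans (near_eq_cvg fg)).
by have : f @ x --> f x := fc; rewrite E.
Qed.

Lemma near_open U f g x : open U -> (forall y, U y -> f y = g y) -> U x ->
  \forall y \near x, f y = g y.
Proof.
move=> Uo fg Ux; have : nbhs x U by exact: open_nbhs_nbhs.
by apply: filterS => y; exact: fg.
Qed.

(** As [U] is open, equality on [U] holds near each of its points and so passes to partial
    derivatives. *)
Lemma Ck_eq r U f g : open U -> (forall x, U x -> f x = g x) ->
  Ck r U f -> Ck r U g.
Proof.
move=> Uo; elim: r f g => [|r IH] f g fg [fc fd]; split.
- by move=> x Ux; apply: continuous_at_near (fc x Ux); exact: near_open Ux.
- by [].
- by move=> x Ux; apply: continuous_at_near (fc x Ux); exact: near_open Ux.
move=> k; have [fk fk'] := fd k; split=> [x Ux|].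
  by apply: near_eq_derivable (fk x Ux); exact: near_open Ux.
apply: IH fk' => x Ux; rewrite /pderiv.
by apply: near_eq_derive; exact: near_open Ux.
Qed.

Lemma Ck_continuous r U f x : Ck r U f -> U x -> {for x, continuous f}.
Proof. by case: r => [|r] [fc _]; exact: fc. Qed.

Lemma CkS_derive r U f k x : Ck r.+1 U f -> U x ->
  is_derive x (delta_mx 0 k : 'rV[R]_N) f (pderiv k f x).
Proof. by move=> [_ /(_ k)[fd _]] Ux; split => //; exact: fd. Qed.

Lemma CkS_pderiv r U f k : Ck r.+1 U f -> Ck r U (pderiv k f).
Proof. by move=> [_ /(_ k)[]]. Qed.

Lemma CkS r U f : Ck r.+1 U f -> Ck r U f.
Proof.
elim: r f => [|r IH] f [fc fd]; split=> // k.
by have [fk fk'] := fd k; split=> //; exact: IH.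
Qed.

(** Lets explicit formulas stand for the partial derivatives, although they match [pderiv k f] on
    [U] only. *)
Lemma Ck_intro r U f (df : 'I_N -> 'rV[R]_N -> R) : open U ->
  (forall x, U x -> {for x, continuous f}) ->
  (forall k x, U x -> is_derive x (delta_mx 0 k : 'rV[R]_N) f (df k x)) ->
  (forall k, Ck r U (df k)) -> Ck r.+1 U f.
Proof.
move=> Uo fc fd dfC; split=> // k; split=> [x Ux|].
  by have [] := fd k x Ux.
apply: Ck_eq (dfC k) => // x Ux.
by rewrite /pderiv; have [_ ->] := fd k x Ux.
Qed.

Lemma Ck_cst r U (a : R) : open U -> Ck r U (fun=> a).
Proof.
move=> Uo; elim: r a => [|r IH] a.
  by split=> // x Ux; exact: cst_continuous.
apply: (@Ck_intro _ _ _ (fun _ _ => 0)) => // x _.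
exact: cst_continuous.
Qed.

Lemma CkD r U f g : open U -> Ck r U f -> Ck r U g ->
  Ck r U (fun x => f x + g x).
Proof.
move=> Uo; elim: r f g => [|r IH] f g fC gC.
  by split=> // x Ux; exact: cvgD (Ck_continuous fC Ux) (Ck_continuous gC Ux).
apply: (@Ck_intro _ _ _ (fun k x => pderiv k f x + pderiv k g x)) => //
  [x Ux|k x Ux|k].
- by exact: cvgD (Ck_continuous fC Ux) (Ck_continuous gC Ux).
- by apply: is_derive_add; [exact: CkS_derive fC Ux|exact: CkS_derive gC Ux].
- by apply: IH; exact: CkS_pderiv.
Qed.

Lemma CkM r U f g : open U -> Ck r U f -> Ck r U g ->
  Ck r U (fun x => f x * g x).
Proof.
move=> Uo; elim: r f g => [|r IH] f g fC gC.
  by split=> // x Ux; exact: cvgM (Ck_continuous fC Ux) (Ck_continuous gC Ux).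
apply: (@Ck_intro _ _ _ (fun k x => pderiv k f x * g x + f x * pderiv k g x)) => //
  [x Ux|k x Ux|k].
- by exact: cvgM (Ck_continuous fC Ux) (Ck_continuous gC Ux).
- by apply: is_derive_mul; [exact: CkS_derive fC Ux|exact: CkS_derive gC Ux].
- by apply: CkD => //; apply: IH;
    [exact: CkS_pderiv|exact: CkS|exact: CkS|exact: CkS_pderiv].
Qed.

Lemma Ck_bigsum r U n (f : 'I_n -> 'rV[R]_N -> R) : open U ->
  (forall i, Ck r U (f i)) -> Ck r U (fun x => \sum_(i < n) f i x).
Proof.
move=> Uo; elim: n f => [|n IH] f fC.
  by apply: Ck_eq (Ck_cst r 0 Uo) => // x _; rewrite big_ord0.
apply: (@Ck_eq _ _
  (fun x => \sum_(i < n) f (widen_ord (leqnSn n) i) x + f ord_max x)) => //.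
  by move=> x _; rewrite big_ord_recr.
by apply: CkD => //; exact: IH.
Qed.

(** The regularity of [dphi \o f] is a premise, so that each [phi] can be treated by an induction
    suited to its own derivatives. *)
Lemma Ck_comp (phi dphi : R -> R) r U f : open U ->
  (forall x, U x -> is_derive (f x : R) (1 : R) phi (dphi (f x))) ->
  Ck r.+1 U f -> Ck r U (dphi \o f) -> Ck r.+1 U (phi \o f).
Proof.
move=> Uo dphiP fC dphiC.
apply: (@Ck_intro _ _ _ (fun k x => dphi (f x) * pderiv k f x)) => //
  [x Ux|k x Ux|k].
- apply: continuous_comp; first exact: Ck_continuous fC Ux.
  apply/differentiable_continuous/derivable1_diffP.
  by have [] := dphiP x Ux.
- by apply: is_derive_comp1; [exact: dphiP|exact: CkS_derive fC Ux].
- by apply: CkM => //; exact: CkS_pderiv.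
Qed.

Lemma pderivC U f i j x : open U -> Ck 2 U f -> U x ->
  pderiv i (pderiv j f) x = pderiv j (pderiv i f) x.
Proof.
move=> Uo fC Ux.
have dC k l : Ck 0 U (pderiv k (pderiv l f)) by do 2 apply: CkS_pderiv.
apply: (@schwarz _ _ f U x) => //.
- by move=> y Uy; have [] := CkS_derive j fC Uy.
- by move=> y Uy; have [] := CkS_derive i fC Uy.
- by move=> y Uy; have [] := CkS_derive i (CkS_pderiv j fC) Uy.
- by move=> y Uy; have [] := CkS_derive j (CkS_pderiv i fC) Uy.
- exact: Ck_continuous (dC i j) Ux.
- exact: Ck_continuous (dC j i) Ux.
Qed.

End CkCalculus.

(** * The hyperbolic metric in polar coordinates *)

Section Hyperbolic.
Variable R : realType.
Implicit Types r s t : R.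

Lemma is_derive_expRN t :
  is_derive t (1 : R) (fun s : R => expR (- s)) (- expR (- t)).
Proof.
have := @is_derive1_comp R expR (fun s : R => - s) t _ _
  (is_derive_expR (- t)) (is_deriveNid t (1 : R)).
by rewrite mulrN1.
Qed.

Lemma is_derive_sinh t : is_derive t (1 : R) (@sinh R) (cosh t).
Proof.
have D := is_deriveB (is_derive_expR t) (is_derive_expRN t).
have := is_derive_mul D (is_derive_cst (2^-1 : R) t (1 : R)).
by rewrite mulr0 addr0 opprK.
Qed.

Lemma is_derive_cosh t : is_derive t (1 : R) (@cosh R) (sinh t).
Proof.
have D := is_derive_add (is_derive_expR t) (is_derive_expRN t).
have := is_derive_mul D (is_derive_cst (2^-1 : R) t (1 : R)).
by rewrite mulr0 addr0.
Qed.

Lemma cosh2B1 t : sinh t ^+ 2 = cosh t ^+ 2 - 1.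
Proof.
have := expRxMexpNx_1 t; rewrite /sinh /cosh => E.
by field: E.
Qed.

Lemma sinh_gt0 t : 0 < t -> 0 < sinh t.
Proof.
by move=> t0; rewrite divr_gt0 // subr_gt0 ltr_expR; lra.
Qed.

Lemma cosh_gt0 t : 0 < cosh t.
Proof. by rewrite divr_gt0 // addr_gt0 // expR_gt0. Qed.

Lemma ltr_cosh s t : 0 <= s -> s < t -> cosh s < cosh t.
Proof.
move=> s0 st.
have [||r rst E] := @MVT R (@cosh R) (@sinh R) s t st.
- by move=> x _; exact: is_derive_cosh.
- by apply: derivable_within_continuous => x _; have [] := is_derive_cosh x.
rewrite -subr_gt0 E mulr_gt0 ?subr_gt0 // sinh_gt0 //.
by move: rst; rewrite in_itv => /andP[/(le_lt_trans s0)].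
Qed.

End Hyperbolic.

(** * Derivatives of functions of the Euclidean norm along a map *)

Section Radial.
Variables (R : realType) (V : normedModType R) (N : nat).
Implicit Types (x v : V) (F G : V -> 'rV[R]_N).

(** Componentwise, because [smooth_map] and [jac] are stated coordinate by coordinate. *)
Definition is_vderive x v F (dF : 'rV[R]_N) :=
  forall k, is_derive x v (fun y => F y 0 k) (dF 0 k).

Lemma is_derive_dot x v F G dF dG : is_vderive x v F dF -> is_vderive x v G dG ->
  is_derive x v (fun y => dot (F y) (G y)) (dot dF (G x) + dot (F x) dG).
Proof.
move=> FD GD; rewrite /dot -big_split /=.
by apply: is_derive_bigsum => k; apply: is_derive_mul.
Qed.

(** The factor [dot (F x) dF / enorm (F x)] is the derivative of [enorm] along [F]. Its denominator
    cancels when [a] is [enorm (F x)] times a coefficient, as for [mA] and [mB]. *)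
Lemma is_derive_radial (phi : R -> R) (a : R) x v F dF :
  F x != 0 -> is_derive (enorm (F x) : R) (1 : R) phi a -> is_vderive x v F dF ->
  is_derive x v (fun y => phi (enorm (F y))) (a * (dot (F x) dF / enorm (F x))).
Proof.
move=> Fx0 phiD FD.
have r0 := enorm_gt0 Fx0.
have FF : 0 < dot (F x) (F x) by rewrite -enorm_sqr exprn_gt0.
have sD := @is_derive_comp1 _ _ _ (fun y => dot (F y) (F y)) _ _ _ _
  (is_derive1_sqrt FF) (is_derive_dot FD FD).
have eD : is_derive x v (fun y => enorm (F y)) (dot (F x) dF / enorm (F x)).
  have -> : (fun y => enorm (F y)) = Num.sqrt \o (fun y => dot (F y) (F y)).
    by apply/funext => y; rewrite /= enormE.
  apply: is_derive_eq sD _; rewrite -enormE (dotC dF).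
  by field; rewrite gt_eqF.
exact: (@is_derive_comp1 _ _ phi (fun y => enorm (F y)) _ _ _ _ phiD eD).
Qed.

End Radial.

(** * The coefficients of the metric in the polar chart *)

Section AmbientMetric.
Variables (R : realType) (n : nat).
Local Notation N := n.+1.
Implicit Types (x v w z : 'rV[R]_N) (r : R).

(* In the chart [polar], the metric is [mA(|x|) <v,w> + mB(|x|) <x,v> <x,w>]. *)
Definition field_coef r : R := sinh r / r.
Definition mA r : R := field_coef r ^+ 2.
Definition mB r : R := (1 - mA r) / r ^+ 2.

(* The derivatives of the coefficients, divided by [r]. *)
Definition field_coef1 r : R := (cosh r - field_coef r) / r ^+ 2.
Definition mA1 r : R := 2 * field_coef r * field_coef1 r.
Definition mB1 r : R := - (mA1 r + 2 * mB r) / r ^+ 2.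

Lemma is_derive_field_coef r : 0 < r ->
  is_derive r (1 : R) field_coef (r * field_coef1 r).
Proof.
move=> r0; have rn : r != 0 by rewrite gt_eqF.
have iD := @is_deriveV R id r _ _ rn (is_derive_id r (1 : R)).
apply: is_derive_eq (is_derive_mul (is_derive_sinh r) iD) _.
by rewrite /field_coef1 /field_coef /GRing.scale /=; field.
Qed.

Lemma is_derive_mA r : 0 < r -> is_derive r (1 : R) mA (r * mA1 r).
Proof.
move=> r0; have fD := is_derive_field_coef r0.
apply: is_derive_eq (is_derive_mul fD fD) _.
by rewrite /mA1; ring.
Qed.

Lemma is_derive_mB r : 0 < r -> is_derive r (1 : R) mB (r * mB1 r).
Proof.
move=> r0; have rn : r != 0 by rewrite gt_eqF.
have iD := @is_deriveV R id r _ _ rn (is_derive_id r (1 : R)).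
have aD := is_deriveB (is_derive_cst (1 : R) r (1 : R)) (is_derive_mA r0).
have D := is_derive_mul (is_derive_mul aD iD) iD.
have -> : mB = (fun y => (cst 1 - mA) y * (id y)^-1 * (id y)^-1).
  by apply/funext => y; rewrite /mB /= expr2 invfM mulrA.
apply: is_derive_eq D _.
rewrite /mB1 /mB /GRing.scale /= -[(cst 1 - mA) r]/(1 - mA r).
by field.
Qed.

Lemma mA_gt0 r : 0 < r -> 0 < mA r.
Proof. by move=> r0; rewrite exprn_gt0 // divr_gt0 // sinh_gt0. Qed.

Lemma is_vderive_id x v : is_vderive x v id v.
Proof.
move=> k; apply/is_derive_lineP.
have D := is_derive_add
   (is_derive_mul (is_derive_id (0 : R) (1 : R))
      (is_derive_cst (v 0 k) (0 : R) (1 : R)))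
   (is_derive_cst (x 0 k) (0 : R) (1 : R)).
have -> : (fun h : R => id (h *: v + x) 0 k) = (fun h : R => id h * v 0 k + x 0 k).
  by apply/funext => h; rewrite !mxE.
by apply: is_derive_eq D _; rewrite mulr0 !addr0 mul1r.
Qed.

Lemma innerE (g : 'M[R]_N) v w :
  inner g v w = \sum_i \sum_j v 0 i * g i j * w 0 j.
Proof.
rewrite /inner mxE exchange_big /=; apply: eq_bigr => j _.
by rewrite !mxE mulr_suml; apply: eq_bigr.
Qed.

Lemma inner1 v w : inner 1%:M v w = dot v w.
Proof. by rewrite /inner mulmx1 mxE; apply: eq_bigr => k _; rewrite mxE. Qed.

Lemma dot_deltas (i j : 'I_N) :
  dot (delta_mx 0 i) (delta_mx 0 j) = (i == j)%:R :> R.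
Proof. by rewrite dot_delta mxE eqxx eq_sym. Qed.

Lemma pderiv_enorm x i : x != 0 -> pderiv i (@enorm R N) x = x 0 i / enorm x.
Proof.
move=> x0.
have [_] := is_derive_radial x0 (is_derive_id (enorm x : R) (1 : R))
  (is_vderive_id x (delta_mx 0 i)).
by rewrite dot_delta mul1r.
Qed.

Lemma row_jac_direction x i : x != 0 ->
  row i (jac (@direction R N) x) =
  (enorm x)^-1 *: delta_mx 0 i + (- (x 0 i / enorm x ^+ 3)) *: x.
Proof.
move=> x0; apply/rowP => k; rewrite !mxE.
have r0 : enorm x != 0 by rewrite gt_eqF // enorm_gt0.
have iD := @is_deriveV R id (enorm x) _ _ r0 (is_derive_id (enorm x : R) (1 : R)).
have rD := is_derive_radial x0 iD (is_vderive_id x (delta_mx 0 i)).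
have [_] := is_derive_mul rD (is_vderive_id x (delta_mx 0 i) k).
have -> : (fun y : 'rV[R]_N => (id (enorm y))^-1 * id y 0 k) =
          (fun y => direction y 0 k).
  by apply/funext => y; rewrite mxE.
rewrite /pderiv => ->.
by rewrite dot_delta !mxE /GRing.scale /=; field.
Qed.

(** With [r = enorm x], the sphere part is [sinh r ^+ 2] times
    [(i == j) / r ^+ 2 - x_i x_j / r ^+ 4], and [dt ^+ 2] contributes [x_i x_j / r ^+ 2]. *)
Lemma warped_metric_sinhE x : x != 0 ->
  warped_metric (@sinh R) x =
  \matrix_(i, j) (mA (enorm x) * (i == j)%:R + mB (enorm x) * (x 0 i * x 0 j)).
Proof.
move=> x0; apply/matrixP => i j; rewrite !mxE.
have r0 : enorm x != 0 by rewrite gt_eqF // enorm_gt0.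
rewrite !pderiv_enorm // inner1 !row_jac_direction //.
rewrite !(dotDl, dotDr, dotZl, dotZr) dot_deltas -enorm_sqr !dot_delta.
rewrite (dotC (delta_mx 0 i)) !dot_delta /mB /mA /field_coef.
by field.
Qed.

Lemma inner_warped x v w : x != 0 ->
  inner (warped_metric (@sinh R) x) v w =
  mA (enorm x) * dot v w + mB (enorm x) * (dot x v * dot x w).
Proof.
move=> x0; rewrite warped_metric_sinhE // innerE.
under eq_bigr => i _ do under eq_bigr => j _ do
  rewrite mxE mulrDr mulrDl.
under eq_bigr => i _ do rewrite big_split.
rewrite big_split /=; congr (_ + _).
  rewrite /dot mulr_sumr; apply: eq_bigr => i _.
  rewrite (bigD1 i) //= eqxx mulr1 big1 ?addr0; first by ring.
  by move=> j; rewrite eq_sym => /negbTE ->; rewrite !mulr0 mul0r.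
rewrite /dot big_distrlr /= mulr_sumr; apply: eq_bigr => i _.
by rewrite mulr_sumr; apply: eq_bigr => j _; ring.
Qed.

End AmbientMetric.

(** * The Levi-Civita connection of the hyperbolic metric *)

Section LinearAlgebra.
Variable R : realType.

(** A vector in the left kernel of [P] is null for the form. This serves both the ambient and the
    induced metric. *)
Lemma definite_unitmx k (P : 'M[R]_k) :
  (forall z : 'rV[R]_k, inner P z z = 0 -> z = 0) -> P \in unitmx.
Proof.
move=> Pdef; rewrite -row_free_unit; apply: inj_row_free => z zP.
by apply: Pdef; rewrite /inner zP mul0mx mxE.
Qed.

Lemma innerDl k (g : 'M[R]_k) u v w : inner g (u + v) w = inner g u w + inner g v w.
Proof. by rewrite /inner !mulmxDl mxE. Qed.

Lemma innerZl k (g : 'M[R]_k) a v w : inner g (a *: v) w = a * inner g v w.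
Proof. by rewrite /inner -!scalemxAl mxE. Qed.

Lemma innerDr k (g : 'M[R]_k) u v w : inner g u (v + w) = inner g u v + inner g u w.
Proof. by rewrite /inner linearD mulmxDr mxE. Qed.

Lemma innerZr k (g : 'M[R]_k) a v w : inner g v (a *: w) = a * inner g v w.
Proof. by rewrite /inner linearZ -scalemxAr mxE. Qed.

Lemma innerNr k (g : 'M[R]_k) v w : inner g v (- w) = - inner g v w.
Proof. by rewrite /inner linearN mulmxN mxE. Qed.

Lemma inner0r k (g : 'M[R]_k) v : inner g v 0 = 0.
Proof. by rewrite /inner linear0 mulmx0 mxE. Qed.

Lemma inner_sumr k (g : 'M[R]_k) v I (s : seq I) (P : pred I) (w : I -> 'rV[R]_k) :
  inner g v (\sum_(i <- s | P i) w i) = \sum_(i <- s | P i) inner g v (w i).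
Proof. exact: (big_morph _ (innerDr g v) (inner0r g v)). Qed.

Lemma linear_form_expand k (f : 'rV[R]_k -> R) v :
  (forall u w, f (u + w) = f u + f w) -> (forall a w, f (a *: w) = a * f w) ->
  f v = \sum_i v 0 i * f (delta_mx 0 i).
Proof.
move=> fD fZ; have f0 : f 0 = 0 by rewrite -(scale0r (0 : 'rV[R]_k)) fZ mul0r.
by rewrite {1}(row_sum_delta v) (big_morph f fD f0); apply: eq_bigr => i _.
Qed.

(** Reduces an identity of trilinear forms to basis vectors, where Christoffel symbols can be
    compared. *)
Lemma trilinear_expand k (f : 'rV[R]_k -> 'rV[R]_k -> 'rV[R]_k -> R) u v w :
  (forall a b c d, f (a + b) c d = f a c d + f b c d) ->
  (forall a b c d, f b (a *: c) d = a * f b c d) ->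
  (forall a b c d, f c (a + b) d = f c a d + f c b d) ->
  (forall a b c d, f (a *: b) c d = a * f b c d) ->
  (forall a b c d, f c d (a + b) = f c d a + f c d b) ->
  (forall a b c d, f b c (a *: d) = a * f b c d) ->
  f u v w = \sum_i \sum_j \sum_l u 0 i * v 0 j * w 0 l *
    f (delta_mx 0 i) (delta_mx 0 j) (delta_mx 0 l).
Proof.
move=> D1 Z2 D2 Z1 D3 Z3.
rewrite (@linear_form_expand _ (fun u => f u v w)) //; apply: eq_bigr => i _.
rewrite (@linear_form_expand _ (fun v => f _ v w)) // mulr_sumr.
apply: eq_bigr => j _.
rewrite (@linear_form_expand _ (f _ _)) // !mulr_sumr; apply: eq_bigr => l _.
by rewrite !mulrA.
Qed.

(** Lowering the index cancels the inverse matrix in [christoffel], so that only derivatives of the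
    metric remain and [invmx] never has to be computed. *)
Lemma christoffel_lower k (g : 'rV[R]_k -> 'M[R]_k) x (i j d : 'I_k) :
  (g x)^T = g x -> g x \in unitmx ->
  \sum_a christoffel g a i j x * g x a d =
  2^-1 * (pderiv i (fun y => g y j d) x + pderiv j (fun y => g y i d) x
          - pderiv d (fun y => g y i j) x).
Proof.
move=> gT gU; rewrite /christoffel.
set T := fun l : 'I_k => pderiv i (fun y => g y j l) x +
  pderiv j (fun y => g y i l) x - pderiv l (fun y => g y i j) x.
rewrite -[X in _ = _ * X]/(T d).
have -> : T d = \sum_l (1%:M : 'M[R]_k) d l * T l.
  rewrite (bigD1 d) //= mxE eqxx mul1r big1 ?addr0 // => l.
  by rewrite eq_sym mxE => /negbTE ->; rewrite mul0r.
rewrite -(mulmxV gU) mulr_sumr.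
under eq_bigr => a _ do rewrite -mulrA mulr_suml mulr_sumr.
rewrite exchange_big /=; apply: eq_bigr => l _.
rewrite mxE !mulr_suml mulr_sumr; apply: eq_bigr => a _.
by rewrite -[in g x d a]gT mxE; rewrite -/(T l); ring.
Qed.

End LinearAlgebra.

(** * Definiteness of the hyperbolic metric and its lowered Christoffel symbols *)

Section WarpedGeometry.
Variables (R : realType) (n : nat).
Local Notation N := n.+1.
Local Notation h := (@warped_metric R n (@sinh R)).
Implicit Types (x v w z : 'rV[R]_N).

Lemma warped_metric_sym x : x != 0 -> (h x)^T = h x.
Proof.
move=> x0; rewrite warped_metric_sinhE //; apply/matrixP => i j.
by rewrite !mxE eq_sym (mulrC (x 0 i)).
Qed.

Lemma inner_warpedC x v w : x != 0 -> inner (h x) v w = inner (h x) w v.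
Proof. by move=> x0; rewrite !inner_warped // dotC (mulrC (dot x v)). Qed.

(** The coefficient [mB] may be negative; in this form the square is a sum of two nonnegative terms,
    the first by Cauchy-Schwarz. Positivity and definiteness follow. *)
Lemma inner_warped_scaled x v : x != 0 -> enorm x ^+ 2 * inner (h x) v v =
  mA (enorm x) * (dot x x * dot v v - dot x v ^+ 2) + dot x v ^+ 2.
Proof.
move=> x0; have r0 : enorm x != 0 by rewrite gt_eqF // enorm_gt0.
by rewrite inner_warped // /mB -(enorm_sqr x); field.
Qed.

Lemma inner_warped_ge0 x v : x != 0 -> 0 <= inner (h x) v v.
Proof.
move=> x0; have r0 := enorm_gt0 x0.
rewrite -(pmulr_rge0 _ (exprn_gt0 2 r0)) inner_warped_scaled //.
by rewrite addr_ge0 ?sqr_ge0 // mulr_ge0 ?(ltW (mA_gt0 r0)) // subr_ge0 cauchy_schwarz.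
Qed.

Lemma inner_warped_eq0 x v : x != 0 -> inner (h x) v v = 0 -> v = 0.
Proof.
move=> x0 hv0; have r0 := enorm_gt0 x0.
have := inner_warped_scaled v x0; rewrite hv0 mulr0 => /esym/eqP.
rewrite paddr_eq0 ?sqr_ge0 //; last first.
  by rewrite mulr_ge0 ?(ltW (mA_gt0 r0)) // subr_ge0 cauchy_schwarz.
case/andP => + /eqP xv0; rewrite xv0 subr0 mulf_eq0 gt_eqF ?mA_gt0 //=.
rewrite mulf_eq0 -(enorm_sqr x) gt_eqF ?exprn_gt0 //= => /eqP.
exact: dot_eq0.
Qed.

Lemma warped_metric_unit x : x != 0 -> h x \in unitmx.
Proof. by move=> x0; apply: definite_unitmx => z; exact: inner_warped_eq0. Qed.

(** Stated along a map with two fields, so that it serves for the derivatives of [h] itself, with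
    constant fields, and for those of the induced metric, with the fields d_a F. *)
Lemma is_derive_inner (V : normedModType R) (p u : V) (F G H : V -> 'rV[R]_N)
    dF dG dH : F p != 0 ->
  is_vderive p u F dF -> is_vderive p u G dG -> is_vderive p u H dH ->
  is_derive p u (fun y => mA (enorm (F y)) * dot (G y) (H y) +
     mB (enorm (F y)) * (dot (F y) (G y) * dot (F y) (H y)))
   (mA1 (enorm (F p)) * dot (F p) dF * dot (G p) (H p) +
    mA (enorm (F p)) * (dot dG (H p) + dot (G p) dH) +
    (mB1 (enorm (F p)) * dot (F p) dF * (dot (F p) (G p) * dot (F p) (H p)) +
     mB (enorm (F p)) *
       ((dot dF (G p) + dot (F p) dG) * dot (F p) (H p) +
        dot (F p) (G p) * (dot dF (H p) + dot (F p) dH)))).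
Proof.
move=> F0 FD GD HD; have r0 := enorm_gt0 F0.
have rn : enorm (F p) != 0 by rewrite gt_eqF.
have D1 := is_derive_mul (is_derive_radial F0 (is_derive_mA r0) FD)
  (is_derive_dot GD HD).
have D2 := is_derive_mul (is_derive_radial F0 (is_derive_mB r0) FD)
  (is_derive_mul (is_derive_dot FD GD) (is_derive_dot FD HD)).
apply: is_derive_eq (is_derive_add D1 D2) _.
by field.
Qed.

Lemma is_vderive_cst (V : normedModType R) (p u : V) v : is_vderive p u (fun=> v) 0.
Proof. by move=> k; rewrite mxE; exact: is_derive_cst. Qed.

Lemma near_neq0 x : x != 0 -> \forall y \near x, y != 0.
Proof.
move=> x0; have [k xk] : exists k, x 0 k != 0.
  apply/existsP; apply: contraNT x0; rewrite negb_exists => /forallP xk.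
  by apply/eqP/rowP => k; rewrite mxE; apply/eqP; rewrite -[_ == _]negbK; exact: xk.
have : nbhs x [set y : 'rV[R]_N | y 0 k != 0].
  have xk' : nbhs (x 0 k) [set t : R | t != 0].
    by apply: open_nbhs_nbhs; split=> //; exact: open_neq.
  exact: (@coord_continuous R 1 N 0 k x _ xk').
by apply: filterS => y; apply: contra_neq => ->; rewrite mxE.
Qed.

Lemma pderiv_warped_metric x i j l : x != 0 ->
  pderiv l (fun y => h y i j) x =
  mA1 (enorm x) * dot x (delta_mx 0 l) * dot (delta_mx 0 i) (delta_mx 0 j) +
  (mB1 (enorm x) * dot x (delta_mx 0 l) *
     (dot x (delta_mx 0 i) * dot x (delta_mx 0 j)) +
   mB (enorm x) *
     (dot (delta_mx 0 l) (delta_mx 0 i) * dot x (delta_mx 0 j) +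
      dot x (delta_mx 0 i) * dot (delta_mx 0 l) (delta_mx 0 j))).
Proof.
move=> x0.
have D := is_derive_inner x0 (is_vderive_id x (delta_mx 0 l))
  (is_vderive_cst x (delta_mx 0 l) (delta_mx 0 i))
  (is_vderive_cst x (delta_mx 0 l) (delta_mx 0 j)).
rewrite /pderiv.
(* The closed form of [h] is valid away from the origin, hence near [x]. *)
rewrite (@near_eq_derive _ _ _ _ (fun y : 'rV[R]_N =>
  mA (enorm y) * dot (delta_mx 0 i) (delta_mx 0 j) +
  mB (enorm y) * (dot y (delta_mx 0 i) * dot y (delta_mx 0 j)))); last first.
  have := near_neq0 x0; apply: filterS => y y0.
  by rewrite warped_metric_sinhE // mxE dot_deltas !dot_delta.
have [_ ->] := D.
have d0 v : dot v 0 = 0 by rewrite -(scale0r (0 : 'rV[R]_N)) dotZr mul0r.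
by rewrite !(dotC 0) !d0; ring.
Qed.

(* [<Gamma(v, w), z>] for the Levi-Civita connection of [h]. *)
Definition gamma_form x v w z : R :=
  2^-1 * (mA1 (enorm x) * (dot x v * dot w z + dot x w * dot v z - dot x z * dot v w)
          + mB1 (enorm x) * (dot x v * dot x w * dot x z))
  + mB (enorm x) * (dot v w * dot x z).

(** Both sides are trilinear in [v], [w], [z]. On basis vectors the left side is a lowered
    Christoffel symbol, known from the derivatives of the metric; the rest is reordering of finite
    sums. *)
Lemma inner_christoffel x v w z : x != 0 ->
  inner (h x) (\row_k \sum_i \sum_j christoffel h k i j x * v 0 i * w 0 j) z =
  gamma_form x v w z.
Proof.
move=> x0.
rewrite (@trilinear_expand _ _ (gamma_form x));
  try by move=> *; rewrite /gamma_form ?(dotDl, dotDr, dotZl, dotZr); ring.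
have G i j d : gamma_form x (delta_mx 0 i) (delta_mx 0 j) (delta_mx 0 d) =
    \sum_a christoffel h a i j x * h x a d.
  rewrite christoffel_lower ?warped_metric_sym ?warped_metric_unit //.
  rewrite !pderiv_warped_metric // /gamma_form !(dotC (delta_mx 0 d)).
  by rewrite (dotC (delta_mx 0 j) (delta_mx 0 i)); field.
rewrite innerE.
under eq_bigr => a _ do under eq_bigr => d _ do rewrite mxE !mulr_suml.
under [RHS]eq_bigr => i _ do under eq_bigr => j _ do under eq_bigr => d _ do
  rewrite G mulr_sumr.
under eq_bigr => a _ do rewrite exchange_big /=.
rewrite exchange_big /=; apply: eq_bigr => i _.
under eq_bigr => a _ do under eq_bigr => d _ do rewrite !mulr_suml.
under eq_bigr => a _ do rewrite exchange_big /=.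
rewrite exchange_big /=; apply: eq_bigr => j _.
rewrite exchange_big /=; apply: eq_bigr => d _.
by apply: eq_bigr => a _; ring.
Qed.

End WarpedGeometry.

(** * Gauss formula and the Laplacian of cosh t *)

Section Submanifold.
Variables (R : realType) (m n : nat).
Local Notation N := n.+1.
Local Notation h := (@warped_metric R n (@sinh R)).
Local Notation X := (@warped_field R n (@sinh R)).

Lemma warped_fieldE (x : 'rV[R]_N) : X x = field_coef (enorm x) *: x.
Proof. by rewrite /warped_field /direction scalerA. Qed.

(** Since [mA r + r ^+ 2 * mB r = 1], the metric agrees with the Euclidean product as soon as one
    argument is radial. *)
Lemma inner_warped_field (x v : 'rV[R]_N) : x != 0 ->
  inner (h x) (X x) v = field_coef (enorm x) * dot x v.
Proof.
move=> x0; have r0 : enorm x != 0 by rewrite gt_eqF // enorm_gt0.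
rewrite warped_fieldE innerZl inner_warped // /mB -(enorm_sqr x).
by field.
Qed.

Lemma inner_warped_field_field (x : 'rV[R]_N) : x != 0 ->
  inner (h x) (X x) (X x) = sinh (enorm x) ^+ 2.
Proof.
move=> x0; have r0 : enorm x != 0 by rewrite gt_eqF // enorm_gt0.
rewrite inner_warped_field // warped_fieldE dotZr -enorm_sqr /field_coef.
by field.
Qed.

Lemma pullback_metricE (g : 'rV[R]_N -> 'M[R]_N) (F : 'rV[R]_m -> 'rV[R]_N) x :
  pullback_metric g F x = jac F x *m g (F x) *m (jac F x)^T.
Proof.
apply/matrixP => a b; rewrite mxE /inner -row_mul mxE [RHS]mxE.
by apply: eq_bigr => k _; rewrite !mxE.
Qed.

Lemma inner_pullback (g : 'rV[R]_N -> 'M[R]_N) (F : 'rV[R]_m -> 'rV[R]_N) x z w :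
  inner (pullback_metric g F x) z w =
  inner (g (F x)) (z *m jac F x) (w *m jac F x).
Proof. by rewrite /inner pullback_metricE trmx_mul !mulmxA. Qed.

Variables (U : set 'rV[R]_m) (F : 'rV[R]_m -> 'rV[R]_N) (x : 'rV[R]_m).
Hypotheses (Uo : open U) (Ux : U x).
Hypothesis FC : forall k, Ck 2 U (fun y => F y 0 k).
(** Imposed at every [y], also outside [U]: in the application [F] factors through [param], whose
    values always lie in the manifold. *)
Hypothesis F0 : forall y, F y != 0.

Let g := pullback_metric h F.
Let J a y := row a (jac F y).

(* Kept opaque: conversion between two distinct second derivatives unfolds the
   limits defining them and does not terminate in practice. *)
Let D2_spec : {D2 : 'I_m -> 'I_m -> 'rV[R]_N | forall a b k,
  D2 a b 0 k = pderiv a (pderiv b (fun y => F y 0 k)) x}.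
Proof.
exists (fun a b => \row_k pderiv a (pderiv b (fun y => F y 0 k)) x) => a b k.
by rewrite mxE.
Qed.

Let D2 := sval D2_spec.
Let D2E : forall a b k, D2 a b 0 k = pderiv a (pderiv b (fun y => F y 0 k)) x :=
  svalP D2_spec.

Let is_vderive_F a y : U y -> is_vderive y (delta_mx 0 a) F (J a y).
Proof.
by move=> Uy k; rewrite !mxE; exact: CkS_derive (FC k) Uy.
Qed.

Let is_vderive_J a b : is_vderive x (delta_mx 0 a) (J b) (D2 a b).
Proof.
move=> k; rewrite D2E.
have -> : (fun y => J b y 0 k) = pderiv b (fun y => F y 0 k).
  by apply/funext => y; rewrite !mxE.
exact: CkS_derive (CkS_pderiv b (FC k)) Ux.
Qed.

Let D2C a b : D2 a b = D2 b a.
Proof. apply/rowP => k.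
exact: (etrans (D2E a b k) (etrans (pderivC a b Uo (FC k) Ux)
  (esym (D2E b a k)))).
Qed.

Let gE a b y : g y a b = mA (enorm (F y)) * dot (J a y) (J b y) +
  mB (enorm (F y)) * (dot (F y) (J a y) * dot (F y) (J b y)).
Proof. by rewrite mxE inner_warped. Qed.

Let gC a b : g x a b = g x b a.
Proof. by rewrite !gE dotC (mulrC (dot _ _)). Qed.

Let gT : (g x)^T = g x.
Proof. by apply/matrixP => a b; rewrite mxE gC. Qed.

Let cov_derivE a b : cov_deriv h F a b x = D2 a b +
  \row_k \sum_i \sum_j christoffel h k i j (F x) * J a x 0 i * J b x 0 j.
Proof.
apply/rowP => k; rewrite [LHS]mxE [RHS]mxE D2E mxE; congr (_ + _).
by apply: eq_bigr => i _; apply: eq_bigr => j _; rewrite !mxE.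
Qed.

Let inner_cov_deriv a b z : inner (h (F x)) (cov_deriv h F a b x) z =
  mA (enorm (F x)) * dot (D2 a b) z +
  mB (enorm (F x)) * (dot (F x) (D2 a b) * dot (F x) z) +
  gamma_form (F x) (J a x) (J b x) z.
Proof. by rewrite cov_derivE innerDl inner_christoffel // inner_warped. Qed.

Let pderiv_g a b d :
  pderiv d (fun y => g y a b) x =
   (mA1 (enorm (F x)) * dot (F x) (J d x) * dot (J a x) (J b x) +
    mA (enorm (F x)) * (dot (D2 d a) (J b x) + dot (J a x) (D2 d b)) +
    (mB1 (enorm (F x)) * dot (F x) (J d x) * (dot (F x) (J a x) * dot (F x) (J b x)) +
     mB (enorm (F x)) *
       ((dot (J d x) (J a x) + dot (F x) (D2 d a)) * dot (F x) (J b x) +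
        dot (F x) (J a x) * (dot (J d x) (J b x) + dot (F x) (D2 d b))))).
Proof.
have [_] := is_derive_inner (F0 x) (is_vderive_F d Ux) (is_vderive_J d a)
  (is_vderive_J d b).
by rewrite /pderiv; under [in X in _ -> X]eq_fun => y do rewrite gE.
Qed.

(** The tangential part of the Gauss formula. In the three derivatives of [g], the symmetry of [D2]
    cancels all second derivatives of [F] but those in [D2 a b]; the remaining terms form
    [gamma_form]. *)
Let gauss a b d : g x \in unitmx ->
  \sum_k christoffel g k a b x * g x k d =
  inner (h (F x)) (cov_deriv h F a b x) (J d x).
Proof.
move=> gU; rewrite christoffel_lower // !pderiv_g inner_cov_deriv /gamma_form.
rewrite (D2C b a) (D2C d a) (D2C d b) (dotC (J b x) (D2 a d)) (dotC (J b x) (J a x)).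
rewrite !(dotC (J d x)) !(dotC (J a x) (D2 _ _)).
by field.
Qed.

Let u y := cosh (enorm (F y)).

Let is_derive_u b y : U y -> is_derive y (delta_mx 0 b : 'rV[R]_m) u
  (field_coef (enorm (F y)) * dot (F y) (J b y)).
Proof.
move=> Uy; have r0 : enorm (F y) != 0 by rewrite gt_eqF // enorm_gt0.
apply: is_derive_eq (is_derive_radial (F0 y) (is_derive_cosh _) (is_vderive_F b Uy)) _.
by rewrite /field_coef; field.
Qed.

Let pderiv_u b y : U y ->
  pderiv b u y = inner (h (F y)) (X (F y)) (J b y).
Proof. by move=> Uy; rewrite inner_warped_field //; have [_] := is_derive_u b Uy. Qed.

(** Coordinate form of Hess(cosh t) = cosh t [h] along [F]: the Hessian on d_a F and d_b F, plus the
    differential of cosh t, which is the pairing with [X], on the covariant derivative of d_b F. *)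
Let pderiv2_u a b : pderiv a (pderiv b u) x =
  u x * g x a b + inner (h (F x)) (X (F x)) (cov_deriv h F a b x).
Proof.
have r0 := enorm_gt0 (F0 x); have rn : enorm (F x) != 0 by rewrite gt_eqF.
have D := is_derive_mul
  (is_derive_radial (F0 x) (is_derive_field_coef r0) (is_vderive_F a Ux))
  (is_derive_dot (is_vderive_F a Ux) (is_vderive_J a b)).
rewrite {1}/pderiv (@near_eq_derive _ _ _ _ (fun y =>
  field_coef (enorm (F y)) * dot (F y) (J b y))); last first.
  by apply: near_open Uo _ Ux => y Uy; rewrite pderiv_u // inner_warped_field.
have [_ ->] := D.
rewrite inner_warpedC // inner_cov_deriv warped_fieldE gE.
rewrite /gamma_form !dotZr !(dotC _ (F x)) -enorm_sqr /u.
rewrite /mB1 /mA1 /mB /mA /field_coef1.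
by field.
Qed.

(** By [gauss], the Christoffel term is the pairing of [X] with the tangential part of [cov_deriv];
    subtracting it leaves the normal part. *)
Let hessian_u a b : g x \in unitmx ->
  pderiv a (pderiv b u) x - \sum_k christoffel g k a b x * pderiv k u x =
  u x * g x a b + inner (h (F x)) (X (F x)) (second_form h F a b x).
Proof.
move=> gU; rewrite pderiv2_u -addrA; congr (_ + _).
rewrite /second_form /normal_part innerDr; congr (_ + _).
rewrite innerNr; congr (- _).
set c := \row_d inner (h (F x)) (cov_deriv h F a b x) (J d x).
have -> : \sum_k christoffel g k a b x * pderiv k u x =
    \sum_k (c *m invmx (g x)) 0 k * pderiv k u x.
  apply: eq_bigr => k _; congr (_ * _).
  (* This is [gauss] in matrix form; inverting [g x] recovers the symbols from the pairings [c]. *)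
  have <- : (\row_k christoffel g k a b x) *m g x = c.
    by apply/rowP => d; rewrite !mxE -gauss //; apply: eq_bigr => l _; rewrite mxE.
  by rewrite mulmxK // mxE.
rewrite inner_sumr; apply: eq_bigr => k _.
rewrite inner_sumr mxE mulr_suml; apply: eq_bigr => d _.
rewrite innerZr -pderiv_u // mxE -[in LHS]gT -trmx_inv mxE.
by rewrite [X in X * _ = _]mulrC.
Qed.

Lemma local_laplacian_cosh_enorm : g x \in unitmx ->
  local_laplacian g u x =
  m%:R * u x + inner (h (F x)) (X (F x)) (mean_curvature h F x).
Proof.
move=> gU; rewrite /local_laplacian /mean_curvature inner_sumr.
(* The dimension enters as the trace of [invmx (g x) *m g x]. *)
have -> : m%:R = \sum_a \sum_b invmx (g x) a b * g x a b.
  transitivity (\sum_(a < m) (invmx (g x) *m g x) a a).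
    rewrite mulVmx //; under eq_bigr => a _ do rewrite mxE eqxx.
    by rewrite sumr_const card_ord.
  apply: eq_bigr => a _; rewrite mxE; apply: eq_bigr => b _.
  by rewrite (gC a b).
rewrite mulr_suml -big_split; apply: eq_bigr => a _ /=.
rewrite inner_sumr mulr_suml -big_split; apply: eq_bigr => b _ /=.
by rewrite hessian_u // innerZr; ring.
Qed.

Hypothesis J_free : row_free (jac F x).

(** Injectivity of the differential carries the definiteness of [h] over to [g]. *)
Lemma pullback_warped_unit : g x \in unitmx.
Proof.
apply: definite_unitmx => z; rewrite inner_pullback => /(inner_warped_eq0 (F0 x)).
by move=> zJ; apply: (row_free_inj J_free); rewrite zJ mul0mx.
Qed.

(** The left side is the squared length of [X] minus that of its tangential part. *)
Lemma inner_normal_part_le :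
  inner (h (F x)) (X (F x)) (normal_part h F x (X (F x))) <=
  sinh (enorm (F x)) ^+ 2.
Proof.
rewrite /normal_part innerDr inner_warped_field_field // innerNr.
rewrite gerBl inner_sumr.
pose w : 'rV[R]_m := \row_a inner (h (F x)) (X (F x)) (J a x).
have -> : \sum_(a < m) inner (h (F x)) (X (F x)) (\sum_(b < m)
     (invmx (pullback_metric h F x) a b *
      inner (h (F x)) (X (F x)) (row b (jac F x))) *: row a (jac F x)) =
    (w *m invmx (g x) *m w^T) 0 0.
  rewrite -mulmxA mxE; apply: eq_bigr => a _.
  rewrite inner_sumr !mxE mulr_sumr; apply: eq_bigr => b _.
  by rewrite innerZr !mxE mulrC.
have gU := pullback_warped_unit.
(* With [z = w *m invmx (g x)], the coordinates of the tangential part, the subtracted term becomes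
   [inner (g x) z z], the squared [h]-length of a tangent vector. *)
have -> : w = w *m invmx (g x) *m g x by rewrite mulmxKV.
move: (w *m invmx (g x)) => z.
rewrite trmx_mul gT mulmxK // mulmxA -/(inner (g x) z z) inner_pullback.
exact: inner_warped_ge0.
Qed.

(** As [c <= 0], multiplication by [c] turns the upper bound on the normal part into a lower bound
    on the Laplacian. *)
Lemma local_laplacian_soliton c : c <= 0 ->
  c *: normal_part h F x (X (F x)) = mean_curvature h F x ->
  m%:R * u x + c * (u x ^+ 2 - 1) <= local_laplacian g u x.
Proof.
move=> c0 sol; rewrite local_laplacian_cosh_enorm ?pullback_warped_unit //.
rewrite lerD2l -sol innerZr -cosh2B1 ler_wnM2l //.
exact: inner_normal_part_le.
Qed.

End Submanifold.

(** * The weak maximum principle *)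

Section SmoothRadius.
Variables (R : realType) (m : nat) (U : set 'rV[R]_m).
Hypothesis Uo : open U.
Implicit Types (f : 'rV[R]_m -> R) (r : nat).

(* The derivative of the square root. Since q' = - 2 q^3, induction on the order
   of differentiation never leaves the powers of [q]. *)
Let q (t : R) : R := (2 * Num.sqrt t)^-1.

Let is_derive_q (t : R) : 0 < t -> is_derive t (1 : R) q (- 2 * (q t * (q t * q t))).
Proof.
move=> t0; have s0 : Num.sqrt t != 0 by rewrite gt_eqF // sqrtr_gt0.
have D := is_derive_mul (is_derive_cst (2 : R) t (1 : R)) (is_derive1_sqrt t0).
have D0 : (2 : R) * Num.sqrt t != 0 by rewrite mulf_neq0 // pnatr_eq0.
apply: is_derive_eq (@is_deriveV R _ t _ _ D0 D) _.
by rewrite /q mul0r add0r /GRing.scale /=; field.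
Qed.

Let Ck_q r f : Ck r U f -> (forall y, U y -> 0 < f y) -> Ck r U (q \o f).
Proof.
move=> fC f0; elim: r fC => [|r IH] fC.
  split=> // y Uy; apply: continuous_comp; first exact: Ck_continuous fC Uy.
  apply/differentiable_continuous/derivable1_diffP.
  by have [] := is_derive_q (f0 y Uy).
apply: (@Ck_comp _ _ _ (fun t => - 2 * (q t * (q t * q t)))) => //.
  by move=> y Uy; exact: is_derive_q (f0 y Uy).
have qC := IH (CkS fC).
apply: (@CkM _ _ _ _ (fun=> - 2)) => //; first exact: Ck_cst.
by apply: CkM => //; exact: CkM.
Qed.

Lemma Ck_sqrt r f : Ck r.+1 U f -> (forall y, U y -> 0 < f y) ->
  Ck r.+1 U (Num.sqrt \o f).
Proof.
move=> fC f0; apply: (@Ck_comp _ _ _ q) => //; last exact: Ck_q (CkS fC) f0.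
by move=> y Uy; exact: is_derive1_sqrt (f0 y Uy).
Qed.

(** Each of the two functions is the derivative of the other, hence the joint induction. *)
Lemma Ck_hyperbolic r f : Ck r U f ->
  Ck r U (@cosh R \o f) /\ Ck r U (@sinh R \o f).
Proof.
elim: r => [|r IH] fC.
  split; split=> // y Uy; apply: continuous_comp; try exact: Ck_continuous fC Uy;
    apply/differentiable_continuous/derivable1_diffP.
    by have [] := is_derive_cosh (f y).
  by have [] := is_derive_sinh (f y).
have [cC sC] := IH (CkS fC).
split; [apply: (Ck_comp _ _ fC sC)|apply: (Ck_comp _ _ fC cC)] => // y _.
  exact: is_derive_cosh.
exact: is_derive_sinh.
Qed.

(** The square root is taken of [dot (F y) (F y)], which is positive because [F] never vanishes. *)
Lemma Ck_cosh_enorm r N (F : 'rV[R]_m -> 'rV[R]_N) :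
  (forall k, Ck r.+1 U (fun y => F y 0 k)) -> (forall y, F y != 0) ->
  Ck r.+1 U (fun y => cosh (enorm (F y))).
Proof.
move=> FC F0.
have dC : Ck r.+1 U (fun y => dot (F y) (F y)).
  by apply: Ck_bigsum => // k; exact: CkM.
have rC : Ck r.+1 U (Num.sqrt \o (fun y => dot (F y) (F y))).
  by apply: Ck_sqrt dC _ => y _; rewrite -enorm_sqr exprn_gt0 // enorm_gt0.
have [cC _] := Ck_hyperbolic rC.
by apply: Ck_eq Uo _ cC => y _; rewrite /= enormE.
Qed.

End SmoothRadius.

Lemma cosh_ge1 (R : realType) (t : R) : 1 <= cosh t.
Proof.
rewrite -(@ler_pXn2r _ 2) ?nnegrE ?(ltW (cosh_gt0 t)) // expr1n.
by rewrite -subr_ge0 -cosh2B1 sqr_ge0.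
Qed.

(** * The function cosh t on the soliton *)

Section Soliton.
Variables (R : realType) (m n : nat) (M : manifold R m).
Variables (psi : M -> R * 'rV[R]_n.+1) (c : R).
Hypothesis psi_warped : forall p : M, warped_product (psi p).
Let Psi (p : M) := polar (psi p).
Local Notation h := (@warped_metric R n (@sinh R)).

Lemma enorm_polar p : enorm (Psi p) = (psi p).1.
Proof.
by have [/ltW t0 e1] := psi_warped p; rewrite enormZ // e1 mulr1.
Qed.

Lemma polar_neq0 p : Psi p != 0.
Proof.
have [t0 _] := psi_warped p.
apply: contraTneq t0 => P0; rewrite -enorm_polar P0 enormE.
by rewrite -(scale0r (0 : 'rV[R]_n.+1)) dotZl mul0r sqrtr0 ltxx.
Qed.

Let u (p : M) : R := cosh (psi p).1.

Let uE (i : Defs.index M) : u \o param i = fun y => cosh (enorm (local_expr Psi i y)).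
Proof. by apply/funext => y; rewrite /= enorm_polar. Qed.

Lemma C2_cosh_radius : immersion Psi -> C2_fun u.
Proof.
move=> [Fsmooth _] i; rewrite uE; apply: Ck_cosh_enorm => [|k|y].
- exact: img_open.
- exact: Fsmooth.
- exact: polar_neq0.
Qed.

(** The estimate in coordinates is applied in the chart selected at [p], whose [param] leads back to
    [p]. *)
Lemma laplacian_cosh_radius p : c <= 0 ->
  mcf_soliton h (@warped_field R n (@sinh R)) c Psi ->
  m%:R * u p + c * (u p ^+ 2 - 1) <= laplacian (induced_metric h Psi) u p.
Proof.
move=> c0 [[Fsmooth Ffree] sol].
rewrite /laplacian uE.
set i := chart_at p; set x := chart i p.
have Fx : local_expr Psi i x = Psi p.
  by rewrite /local_expr /= chartK //; exact: dom_chart_at.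
have Ux : img i x by exists p => //; exact: dom_chart_at.
have := @local_laplacian_soliton R m n (img i) (local_expr Psi i) x
  (@img_open _ _ M i) Ux
  (fun k => Fsmooth i k 2) (fun y => polar_neq0 _) (Ffree p) c c0.
by rewrite Fx enorm_polar; apply; exact: sol.
Qed.

End Soliton.

Theorem corollary7p11 (R : realType) (m n : nat) (M : manifold R m)
    (psi : M -> R * 'rV[R]_n.+1) (c : R)
    (psi_warped : forall p : M, warped_product (psi p))
    (c_lt0 : c < 0)
    (soliton : mcf_soliton (warped_metric (@sinh R)) (warped_field (@sinh R)) c
                 (fun p : M => polar (psi p)))
    (complete : stochastically_complete
                  (induced_metric (warped_metric (@sinh R))
                                  (fun p : M => polar (psi p)))) :
  ((arccosh (- ((m%:R + Num.sqrt (m%:R ^+ 2 + 4 * c ^+ 2)) / (2 * c))))%:E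
     <= ereal_sup [set ((psi p).1)%:E | p in [set: M]])%E.
Proof.
set y0 := - _; set S := ereal_sup _.
have cn : c != 0 by rewrite lt_eqF.
have m0 : 0 <= m%:R :> R by [].
(* The roots of this quadratic have product [-1]: [y0] is the positive one and [- y0^-1] the
   other. *)
have y0_root : c * y0 ^+ 2 + m%:R * y0 - c = 0.
  have : 0 <= m%:R ^+ 2 + 4 * c ^+ 2 :> R.
    by rewrite addr_ge0 ?sqr_ge0 // mulr_ge0 ?sqr_ge0.
  move/sqr_sqrtr.
  rewrite /y0; set s := Num.sqrt _ => E.
  by field: E.
(* Gives [cosh (arccosh y0) = y0]; the reason is that the square root is at least [2 * |c|], which
   is [- (2 * c)]. *)
have y0_ge1 : 1 <= y0.
  have s_ge : - (2 * c) <= Num.sqrt (m%:R ^+ 2 + 4 * c ^+ 2).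
    rewrite -[leLHS]ger0_norm; last by lra.
    rewrite -sqrtr_sqr ler_wsqrtr // (_ : (- (2 * c)) ^+ 2 = 4 * c ^+ 2); last by ring.
    by rewrite lerDr sqr_ge0.
  rewrite /y0 -mulrN -invrN ler_pdivlMr; last by lra.
  by rewrite mul1r; lra.
rewrite leNgt; apply/negP => S_lt.
have [p0 _] := manifold_nonempty M.
have S_ub p : ((psi p).1%:E <= S)%E by apply: ereal_sup_ubound; exists p.
(* The value [+oo] is excluded by the assumed strict inequality, and [-oo] by the point [p0]. *)
have [T ST] : exists T, S = T%:E.
  move: S_lt (S_ub p0); case: (S) => [T _ _|//|//].
  by exists T.
rewrite ST lte_fin in S_lt.
have le_T p : (psi p).1 <= T by rewrite -lee_fin -ST.
have pos p : 0 < (psi p).1 by have [] := psi_warped p.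
have T_lt : cosh T < y0.
  rewrite -(arccoshK y0_ge1) ltr_cosh //.
  by rewrite (le_trans _ (le_T p0)) // ltW.
have u_le p : cosh (psi p).1 <= cosh T.
  have := le_T p; rewrite le_eqVlt => /orP[/eqP->//|pT].
  by rewrite ltW // ltr_cosh // ltW.
pose u (p : M) := cosh (psi p).1.
(* In the factorisation [- c * (y0 - u p) * (u p + y0^-1)] below, the middle factor is at least
   [y0 - cosh T] and the last one at least [1]. *)
pose delta := - c * (y0 - cosh T).
have delta0 : 0 < delta by rewrite mulr_gt0 ?oppr_gt0 // subr_gt0.
have lap p : delta <= laplacian (induced_metric (warped_metric (@sinh R))
    (fun p => polar (psi p))) u p.
  apply: le_trans (laplacian_cosh_radius psi_warped p (ltW c_lt0) soliton).
  rewrite -/(u p).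
  have := u_le p; rewrite -/(u p) => up_le.
  have up_ge : 1 <= u p := cosh_ge1 _.
  have yn : y0 != 0 by rewrite gt_eqF // (lt_le_trans ltr01).
  have -> : m%:R * u p + c * (u p ^+ 2 - 1) = - c * (y0 - u p) * (u p + y0^-1).
    (* The quadratic equation of [y0], solved for the dimension. *)
    have -> : m%:R = (c - c * y0 ^+ 2) / y0.
      apply: (mulIf yn); rewrite divfK //; lra.
    by field.
  apply: (@le_trans _ _ (- c * (y0 - u p))).
    by rewrite /delta ler_wpM2l //; lra.
  rewrite ler_peMr //; first by rewrite mulr_ge0 //; lra.
  have : 0 <= y0^-1 by rewrite invr_ge0; lra.
  lra.
have C2u := C2_cosh_radius psi_warped soliton.1.
have u_bdd : (ereal_sup [set (u p)%:E | p in [set: M]] < +oo)%E.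
  apply: (@le_lt_trans _ _ (cosh T)%:E); last exact: ltry.
  by apply: ge_ereal_sup => _ [p _ <-]; rewrite lee_fin; exact: u_le.
have u_pos : (0%:E < ereal_sup [set (u p)%:E | p in [set: M]])%E.
  apply: (@lt_le_trans _ _ (u p0)%:E); first by rewrite lte_fin cosh_gt0.
  by apply: ereal_sup_ubound; exists p0.
(* Since [u] is positive, its superlevel set at [0] is all of [M]; the infimum of the Laplacian
   there is at least [delta]. *)
have := complete u C2u u_bdd 0 u_pos.
apply/negP; rewrite -ltNge.
apply: (@lt_le_trans _ _ delta%:E); first by rewrite lte_fin.
by apply: le_ereal_inf_tmp => _ [p _ <-]; rewrite lee_fin; exact: lap.
Qed.
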